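(* For $B>0$ let $(x_1,x_2,x_3)=(x_1^B,x_2^B,x_3^B)$ be an optimal path with total emission $x_2(T)+x_3(T)=B$, i.e. a minimizer of the rate function $I$ under this constraint (as defined in the context). Then $$\lim_{B\to\infty}\frac{x_2(T)}{x_3(T)}=0.$$
   Context: Fix constants $\lambda,\mu,\nu>0$ and $T>0$, and a parameter $u\in[0,1]$. For functions $x_1,x_2,x_3\in C^1[0,T]$ with $0\le x_1\le 1$ and $x_2(0)=x_3(0)=0$, the rate function is $$\begin{aligned}I(x_1,x_2,x_3)=\int_0^T\sup_{\varkappa_1,\varkappa_2,\varkappa_3\in\mathbb{R}}\Bigl(&\varkappa_1\dot x_1(t)+\varkappa_2\dot x_2(t)+\varkappa_3\dot x_3(t)-\lambda(1-x_1(t))[e^{\varkappa_1}-1]\\&-\mu x_1(t)[e^{-\varkappa_1+\varkappa_2}-1]-\nu x_1(t)[e^{-\varkappa_1+2\varkappa_3}-1]\Bigr)\,dt .\end{aligned}$$ Here $x_1$ is the scaled number of excited atoms, $x_2$ the scaled number of spontaneously emitted photons and $x_3$ the scaled number of photons produced by stimulated emission. An optimal path with total emission $B$ is a triple $(x_1,x_2,x_3)$ of $C^1$ functions on $[0,T]$ with $0\le x_1\le1$, $x_1(0)=u$, $x_2(0)=x_3(0)=0$ and $x_2(T)+x_3(T)=B$ at which the infimum of $I$ over all such triples is attained. *)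

(* Defs.v *)
From HB Require Import structures.
From mathcomp Require Import all_boot all_order all_algebra.
From mathcomp Require Import all_classical all_reals all_analysis.

Set Implicit Arguments.
Unset Strict Implicit.
Unset Printing Implicit Defensive.

Import Order.TTheory GRing.Theory Num.Theory.
Import numFieldNormedType.Exports.

Local Open Scope ring_scope.
Local Open Scope classical_set_scope.

(* f is continuous on [a, b] and differentiable inside, and its derivative
   extends continuously to [a, b].  Values of f outside [a, b] are ignored. *)
Definition C1_on (R : realType) (a b : R) (f : R -> R) : Prop :=
  derivable_oo_LRcontinuous f a b /\
  exists2 df : R -> R,
    {within `[a, b], continuous df} & {in `]a, b[%R, f^`() =1 df}.

(* [y] is the current value of x1 and [v1, v2, v3] are the velocities;
   the value may be +oo. *)
Definition local_rate (R : realType) (lambda mu nu y v1 v2 v3 : R) : \bar R :=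
  ereal_sup [set z : \bar R | exists k1 k2 k3 : R,
    z = (k1 * v1 + k2 * v2 + k3 * v3
         - lambda * (1 - y) * (expR k1 - 1)
         - mu * y * (expR (- k1 + k2) - 1)
         - nu * y * (expR (- k1 + 2 * k3) - 1))%:E].

(* The two-sided derivatives are meaningful on ]0, T[ only; the endpoints
   are negligible for the Lebesgue measure.  The integrand is nonnegative
   (take k1 = k2 = k3 = 0), so the integral is defined in [0, +oo]. *)
Definition rate_function (R : realType) (lambda mu nu T : R)
    (x1 x2 x3 : R -> R) : \bar R :=
  (\int[lebesgue_measure]_(t in `[0%R, T])
     local_rate lambda mu nu (x1 t)
       (derive1 x1 t) (derive1 x2 t) (derive1 x3 t))%E.

Definition admissible_path (R : realType) (T u B : R)
    (x1 x2 x3 : R -> R) : Prop :=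
  [/\ C1_on 0 T x1, C1_on 0 T x2 & C1_on 0 T x3] /\
  [/\ (forall t : R, t \in `[0, T]%R -> 0 <= x1 t <= 1),
      x1 0 = u, x2 0 = 0, x3 0 = 0 & x2 T + x3 T = B].

Definition optimal_path (R : realType) (lambda mu nu T u B : R)
    (x1 x2 x3 : R -> R) : Prop :=
  admissible_path T u B x1 x2 x3 /\
  forall y1 y2 y3 : R -> R, admissible_path T u B y1 y2 y3 ->
    (rate_function lambda mu nu T x1 x2 x3
       <= rate_function lambda mu nu T y1 y2 y3)%E.

(* Main.v *)
Require Import Defs.
From HB Require Import structures.
From mathcomp Require Import all_boot all_order all_algebra.
From mathcomp Require Import all_classical all_reals all_analysis.
From mathcomp Require Import measurable_realfun ring lra.

Import Order.TTheory GRing.Theory Num.Theory.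
Import numFieldNormedType.Exports.

Local Open Scope ring_scope.
Local Open Scope classical_set_scope.

(** Write a = x1' + x2' + x3'/2, b = x2' and c = x3'/2 for the speeds of
    excitation, spontaneous emission and stimulated emission. The change of
    variables th1 = k1, th2 = -k1 + k2, th3 = -k1 + 2 k3 splits the supremum
    in the rate function into three independent ones: a reaction running at
    speed v with intensity r costs the supremum over th of
    th v - r (e^th - 1), which is v ln (v/r) - v + r. As the
    intensities are bounded, N events in time T cost at least N ln N to
    leading order.

    A stimulated emission releases two photons and a spontaneous one releases
    a single photon, and every emission must be paid for by an excitation. With
    x2(T) + x3(T) = B, the number of events of the three kinds is, up to a
    bounded error,
      2 x2(T) + x3(T) = B + x2(T),
    so that each spontaneous photon costs an extra ln B. More precisely:

    - lower bound: taking th1 = th2 = th3 = ln B in the supremum at every time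
      gives I >= (B + x2(T) - 1) ln B - (lambda + mu + nu) T B
      (rate_function_ge);
    - upper bound: a path without spontaneous emission has
      I <= B ln B + O(B) (rate_function_test_path_le, optimal_rate_le).

    An optimal path satisfies both, hence x2(T) ln B = O(B)
    (optimal_spontaneous_bound). It also has x2(T) >= 0, because its cost is
    finite. Therefore x2(T) / B tends to 0, x3(T) / B tends to 1, and the
    ratio x2(T) / x3(T) is O(1 / ln B). *)

(** * Integrals *)

(** Both parts of the integral are suprema over simple functions, hence monotone
    for an arbitrary integrand such as the local rate, an uncountable supremum.
    Two domains D and E allow comparing an open interval with its closure, where
    the derivatives at the endpoints are arbitrary. *)
Lemma le_integral_patch (d : measure_display) (S : measurableType d)
    (R : realType) (m : {measure set S -> \bar R}) (D E : set S)
    (f g : S -> \bar R) :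
  (forall x, (f \_ D) x <= (g \_ E) x)%E ->
  (\int[m]_(x in D) f x <= \int[m]_(x in E) g x)%E.
Proof.
move=> fg; rewrite /integral.
apply: leeB; apply: ereal_sup_le => _ [h hle <-];
  exists h => //= x; apply: (le_trans (hle x)).
- by rewrite !funeposE ge_max !le_max lexx fg orbT.
- by rewrite !funenegE ge_max !le_max lexx leeN2 fg orbT.
Qed.

Lemma integral_FTC_oo (R : realType) (a b : R) (F f : R -> R) : a < b ->
  {within `[a, b], continuous f} ->
  derivable_oo_LRcontinuous F a b -> {in `]a, b[%R, F^`() =1 f} ->
  (\int[lebesgue_measure]_(t in `]a, b[) (f t)%:E = (F b - F a)%:E)%E.
Proof.
move=> ab cf dF F'f; rewrite EFinB -(continuous_FTC2 ab cf dF F'f).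
rewrite (@integral_itv_bndoo _ _ _ (EFin \o f) true false) //.
apply/measurable_EFinP.
apply: (@measurable_funS _ _ _ _ `[a, b]%classic) => //.
  exact: subset_itv_oo_cc.
apply: subspace_continuous_measurable_fun => //.
Qed.

(** * Lower bound for the rate function *)

Lemma local_rate_ge (R : realType) (lambda mu nu y v1 v2 v3 k1 k2 k3 : R) :
  ((k1 * v1 + k2 * v2 + k3 * v3
         - lambda * (1 - y) * (expR k1 - 1)
         - mu * y * (expR (- k1 + k2) - 1)
         - nu * y * (expR (- k1 + 2 * k3) - 1))%:E
     <= local_rate lambda mu nu y v1 v2 v3)%E.
Proof. by apply: ereal_sup_ubound; exists k1, k2, k3. Qed.

Lemma local_rate_ge0 (R : realType) (lambda mu nu y v1 v2 v3 : R) :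
  (0 <= local_rate lambda mu nu y v1 v2 v3)%E.
Proof.
apply: le_trans (@local_rate_ge _ _ _ _ _ _ _ _ 0 0 0).
by rewrite !(mul0r, mulr0, addr0, oppr0, expR0, subrr).
Qed.

(** Constant multipliers k1, k2, k3 bound the cost from below by the endpoint
    values of the path alone: the terms linear in the velocities integrate
    exactly, and the others are at most C. *)
Lemma rate_function_ge (R : realType) (lambda mu nu T k1 k2 k3 C : R)
    (x1 x2 x3 : R -> R) : 0 < T ->
  [/\ C1_on 0 T x1, C1_on 0 T x2 & C1_on 0 T x3] ->
  (forall t, t \in `[0, T]%R ->
     lambda * (1 - x1 t) * (expR k1 - 1) + mu * x1 t * (expR (- k1 + k2) - 1)
       + nu * x1 t * (expR (- k1 + 2 * k3) - 1) <= C) ->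
  ((k1 * (x1 T - x1 0) + k2 * (x2 T - x2 0) + k3 * (x3 T - x3 0) - C * T)%:E
     <= rate_function lambda mu nu T x1 x2 x3)%E.
Proof.
move=> T0 [[D1 [d1 c1 e1]] [D2 [d2 c2 e2]] [D3 [d3 c3 e3]]] hC.
pose F t := k1 * x1 t + k2 * x2 t + k3 * x3 t - C * t.
pose f t := k1 * d1 t + k2 * d2 t + k3 * d3 t - C.
have dF t : t \in `]0, T[%R -> is_derive t 1 F (f t).
  move=> t0T; have [dx1 dx2 dx3] : [/\ is_derive t 1 x1 (d1 t),
      is_derive t 1 x2 (d2 t) & is_derive t 1 x3 (d3 t)].
    have [i1 _ _] := D1; have [i2 _ _] := D2; have [i3 _ _] := D3.
    rewrite -(e1 t t0T) -(e2 t t0T) -(e3 t t0T) !derive1E.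
    by split; apply/derivableP; [exact: i1|exact: i2|exact: i3].
  by apply: is_derive_eq; rewrite /f /GRing.scale /=; ring.
have -> : k1 * (x1 T - x1 0) + k2 * (x2 T - x2 0) + k3 * (x3 T - x3 0) - C * T
    = F T - F 0 by rewrite /F; ring.
rewrite -(@integral_FTC_oo _ _ _ F f) //; first last.
- by move=> t t0T; rewrite derive1E; case: (dF t t0T).
- have [i1 r1 l1] := D1; have [i2 r2 l2] := D2; have [i3 r3 l3] := D3.
  have cC : forall (A : set_system R) s, Filter A -> A --> s ->
      C * t @[t --> A] --> C * s by move=> A s FA As; exact: cvgMl_tmp As.
  split; first by move=> t t0T; case: (dF t t0T).
  + apply: cvgB; last by apply: cC; apply: cvg_at_right_filter; exact: cvg_id.
    by apply: cvgD; [apply: cvgD|]; exact: cvgMl_tmp.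
  + apply: cvgB; last by apply: cC; apply: cvg_at_left_filter; exact: cvg_id.
    by apply: cvgD; [apply: cvgD|]; exact: cvgMl_tmp.
- move=> t; apply: cvgB; last exact: cvg_cst.
  apply: cvgD; [apply: cvgD|]; apply: cvgMl_tmp; [exact: c1|exact: c2|exact: c3].
apply: le_integral_patch => t; rewrite !patchE.
case: ifPn => [tI|_]; last by case: ifPn => // _; exact: local_rate_ge0.
move: tI; rewrite inE /= => tI.
have tI' : t \in `[0, T]%R by exact: subset_itv_oo_cc.
rewrite mem_set //.
apply: le_trans (@local_rate_ge _ _ _ _ _ _ _ _ k1 k2 k3).
rewrite lee_fin /f -(e1 t tI) -(e2 t tI) -(e3 t tI).
have := hC t tI'; lra.
Qed.

(** * Cost of a path without spontaneous emission *)

(** The cost v ln (v/r) - v + r of a reaction at the speed v = n t / T^2, when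
    its intensity r is allowed to vanish like t^2 at 0: the speed vanishes too,
    and this compensates the logarithm, since - t ln t <= 1. The speed
    integrates to n/2 over [0, T]. The proof is the convexity inequality
    e^th >= q (1 + th - ln q) at q = n / (r0 t), the ratio of the speed to the
    lower bound of the intensity. *)
Lemma reaction_cost_le (R : realType) (n r0 r T t th : R) :
  0 < n -> 0 < r0 -> 0 < T -> 0 <= t -> r0 * (t / T) ^+ 2 <= r ->
  th * (n * t / T ^+ 2) - r * (expR th - 1)
    <= n * t / T ^+ 2 * (ln n - ln r0) + n / T ^+ 2 + r.
Proof.
move=> n0 r00 T0 t0 hr.
have W0 : 0 < (T ^+ 2)^-1 by rewrite invr_gt0 exprn_gt0.
move: hr; rewrite expr_div_n; set W := (T ^+ 2)^-1 in W0 * => hr.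
have E0 := expR_gt0 th.
have rE : r0 * (t ^+ 2 * W) * expR th <= r * expR th by rewrite ler_pM2r.
case: (ltgtP t 0) t0 => // [t0 _|t0 _]; last first.
  move: rE; rewrite t0 expr0n /= !(mul0r, mulr0); nra.
have q0 : 0 < n / (r0 * t) by rewrite divr_gt0 // mulr_gt0.
have Eq : n / (r0 * t) * (1 + (th - ln (n / (r0 * t)))) <= expR th.
  rewrite [leRHS](_ : _ = n / (r0 * t) * expR (th - ln (n / (r0 * t)))).
    by rewrite ler_pM2l // expR_ge1Dx.
  rewrite -{1}(@lnK _ (n / (r0 * t))) ?posrE // -expRD.
  by congr expR; ring.
have lnq : ln (n / (r0 * t)) = ln n - ln r0 - ln t.
  by rewrite ln_div ?posrE ?mulr_gt0 // lnM ?posrE //; ring.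
have tln : - (t * ln t) <= 1 - t.
  have : ln (1 + (t^-1 - 1)) <= t^-1 - 1.
    by apply: le_ln1Dx; rewrite ltrBrDl subrr invr_gt0.
  rewrite addrC subrK lnV ?posrE // -(ler_pM2l t0) mulrBr divff ?gt_eqF //.
  by rewrite mulrN mulr1.
have key : n * t * W * (1 + (th - (ln n - ln r0 - ln t))) <= r * expR th.
  apply: le_trans rE; rewrite -lnq.
  apply: (@le_trans _ _ (r0 * (t ^+ 2 * W) *
     (n / (r0 * t) * (1 + (th - ln (n / (r0 * t))))))).
    rewrite le_eqVlt; apply/orP; left; apply/eqP; field.
    by rewrite !gt_eqF.
  by rewrite ler_wpM2l // !mulr_ge0 ?ltW // exprn_ge0 // ltW.
have nW : 0 < n * W by rewrite mulr_gt0.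
have : n * W * - (t * ln t) <= n * W * (1 - t) by rewrite ler_pM2l.
have : 0 < n * W * t by rewrite mulr_gt0.
lra.
Qed.

Definition quadratic {R : realType} (a b t : R) : R := a + b * t ^+ 2.

Lemma is_derive_quadratic (R : realType) (a b t : R) :
  is_derive t 1 (quadratic a b) (2 * b * t).
Proof. by apply: is_derive_eq; rewrite /GRing.scale /=; ring. Qed.

Lemma derive1_quadratic (R : realType) (a b t : R) :
  (quadratic a b)^`() t = 2 * b * t.
Proof. by rewrite derive1E; have [_ ->] := @is_derive_quadratic _ a b t. Qed.

Lemma continuous_affine (R : realType) (a b : R) :
  continuous (fun t => a * t + b).
Proof. by move=> t; apply: cvgD; [apply: cvgMl_tmp; exact: cvg_id|exact: cvg_cst]. Qed.

Lemma derivable_LRcontinuous (R : realType) (f : R -> R) (x y : R) :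
  (forall t, derivable f t 1) -> derivable_oo_LRcontinuous f x y.
Proof.
move=> df; have cf t : {for t, continuous f}.
  by apply: differentiable_continuous; exact/derivable1_diffP.
by split=> [t _| |]; [|exact: cvg_at_right_filter (cf _)
  |exact: cvg_at_left_filter (cf _)].
Qed.

Lemma C1_on_quadratic (R : realType) (x y a b : R) : C1_on x y (quadratic a b).
Proof.
split; first by apply: derivable_LRcontinuous => t; case: (@is_derive_quadratic _ a b t).
exists (fun t => 2 * b * t + 0).
  exact/continuous_subspaceT/continuous_affine.
by move=> t _; rewrite derive1_quadratic addr0.
Qed.

Lemma integral_affine (R : realType) (T a b : R) : 0 < T ->
  (\int[lebesgue_measure]_(t in `[0%R, T]) (a * t + b)%:E
     = (a * T ^+ 2 / 2 + b * T)%:E)%E.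
Proof.
move=> T0; pose F t := a / 2 * t ^+ 2 + b * t.
have dF (t : R) : is_derive t 1 F (a * t + b).
  by apply: is_derive_eq; rewrite /GRing.scale /=; field.
rewrite (@continuous_FTC2 _ _ F) //.
- by rewrite -EFinB /F; congr EFin; field.
- exact/continuous_subspaceT/continuous_affine.
- by apply: derivable_LRcontinuous => t; case: (dF t).
- by move=> t _; rewrite derive1E; case: (dF t).
Qed.

(** The excited proportion goes from u to 1/2 along a parabola. Even if u is 0
    or 1, the intensities of excitation and of stimulated emission are then
    bounded below by a multiple of t^2, as reaction_cost_le requires. *)
Lemma quadratic_to_half (R : realType) (T u t : R) : 0 < T -> 0 <= u <= 1 ->
  t \in `[0, T]%R ->
  (t / T) ^+ 2 / 2 <= quadratic u ((1 / 2 - u) / T ^+ 2) t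
                   <= 1 - (t / T) ^+ 2 / 2.
Proof.
move=> T0 /andP[u0 u1]; rewrite in_itv /= => /andP[t0 tT].
have -> : quadratic u ((1 / 2 - u) / T ^+ 2) t = u + (1 / 2 - u) * (t / T) ^+ 2.
  by rewrite /quadratic; field; rewrite gt_eqF.
have : 0 <= (t / T) ^+ 2 <= 1.
  rewrite exprn_ge0 ?divr_ge0 ?(ltW T0) //=.
  by rewrite exprn_ile1 ?divr_ge0 ?(ltW T0) // ler_pdivrMr // mul1r.
set s := (t / T) ^+ 2 => /andP[s0 s1].
by apply/andP; split; nra.
Qed.

Lemma admissible_test_path (R : realType) (T u B : R) : 0 < T -> 0 <= u <= 1 ->
  admissible_path T u B (quadratic u ((1 / 2 - u) / T ^+ 2))
    (quadratic 0 0) (quadratic 0 (B / T ^+ 2)).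
Proof.
move=> T0 hu; split; first by split; exact: C1_on_quadratic.
split; rewrite /quadratic ?expr0n ?mulr0 ?addr0 //.
- move=> t /(quadratic_to_half _ _ _ _ T0 hu) /andP[h1 h2].
  have : 0 <= (t / T) ^+ 2 by exact: sqr_ge0.
  by rewrite /quadratic in h1 h2; move=> h; apply/andP; split; lra.
- by rewrite mul0r !add0r divfK // gt_eqF // exprn_gt0.
Qed.

(** Along this path the excitation speed is n t / T^2, the stimulated emission
    speed is B t / T^2, and nothing is emitted spontaneously. Since n and B
    differ by at most 1, the two halves n ln n / 2 and B ln B / 2 add up to
    B ln B to leading order. *)
Lemma rate_function_test_path_le (R : realType) (lambda mu nu T u B n : R) :
  0 < lambda -> 0 < mu -> 0 < nu -> 0 < T -> 0 <= u <= 1 -> 2 <= B ->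
  n = B + 1 - 2 * u ->
  (rate_function lambda mu nu T (quadratic u ((1 / 2 - u) / T ^+ 2))
    (quadratic 0 0) (quadratic 0 (B / T ^+ 2))
   <= ((n * (ln n - ln (lambda / 2)) + B * (ln B - ln (nu / 2))) / 2
       + (n + B) / T + (lambda + mu + nu) * T)%:E)%E.
Proof.
move=> l0 m0 n0 T0 hu B2 nE.
have /andP[u0 u1] := hu.
pose A := (n * (ln n - ln (lambda / 2)) + B * (ln B - ln (nu / 2))) / T ^+ 2.
pose D := (n + B) / T ^+ 2 + (lambda + mu + nu).
apply: (@le_trans _ _ (\int[lebesgue_measure]_(t in `[0%R, T]) (A * t + D)%:E)%E);
  last first.
  rewrite integral_affine // lee_fin /A /D le_eqVlt; apply/orP; left.
  by apply/eqP; field; rewrite gt_eqF.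
apply: le_integral_patch => t; rewrite !patchE; case: ifPn => // tI.
have {}tI : t \in `[0, T]%R by move: tI; rewrite inE.
have t0 : 0 <= t by move: tI; rewrite in_itv /= => /andP[].
have /andP[hy1 hy2] := quadratic_to_half _ _ _ _ T0 hu tI.
apply: ge_ereal_sup => _ [k1 [k2 [k3 ->]]].
rewrite !derive1_quadratic lee_fin.
set y := quadratic u _ t in hy1 hy2 *.
have W0 : 0 <= (t / T) ^+ 2 by exact: sqr_ge0.
have y0 : 0 <= y by lra.
have y1 : y <= 1 by lra.
have n_gt0 : 0 < n by rewrite nE; lra.
have B_gt0 : 0 < B by lra.
have a1 := @reaction_cost_le _ n (lambda / 2) (lambda * (1 - y)) T t k1 n_gt0
  (divr_gt0 l0 (ltr0n _ 2)) T0 t0 ltac:(nra).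
have a3 := @reaction_cost_le _ B (nu / 2) (nu * y) T t (- k1 + 2 * k3) B_gt0
  (divr_gt0 n0 (ltr0n _ 2)) T0 t0 ltac:(nra).
have a2 : - (mu * y * (expR (- k1 + k2) - 1)) <= mu * y.
  have : 0 <= mu * y * expR (- k1 + k2).
    by rewrite mulr_ge0 ?expR_ge0 // mulr_ge0 // ltW.
  lra.
have b1 : lambda * (1 - y) <= lambda by nra.
have b2 : mu * y <= mu by nra.
have b3 : nu * y <= nu by nra.
move: a1 a2 a3; rewrite /A /D nE; lra.
Qed.

(** * Optimal paths *)

(** An optimal path costs no more than the explicit one. The constant K collects
    everything that is at most linear in B. *)
Lemma optimal_rate_le (R : realType) (lambda mu nu T u : R) :
  0 < lambda -> 0 < mu -> 0 < nu -> 0 < T -> 0 <= u <= 1 ->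
  exists K : R, forall (B : R) (x1 x2 x3 : R -> R), 2 <= B ->
    optimal_path lambda mu nu T u B x1 x2 x3 ->
    (rate_function lambda mu nu T x1 x2 x3 <= (B * ln B + K * B)%:E)%E.
Proof.
move=> l0 m0 n0 T0 hu; have [u0 u1] := andP hu.
exists (1 + `|ln (lambda / 2)| + `|ln (nu / 2)| + 3 / T + (lambda + mu + nu) * T).
move=> B x1 x2 x3 B2 [_ opt].
apply: le_trans (opt _ _ _ (@admissible_test_path _ T u B T0 hu)) _.
apply: le_trans (@rate_function_test_path_le _ _ _ _ _ _ _ _ l0 m0 n0 T0 hu B2 erefl) _.
rewrite lee_fin; set n := B + 1 - 2 * u.
have B_gt0 : 0 < B by lra.
have n_gt0 : 0 < n by rewrite /n; lra.
have nln : n * ln n <= B * ln B + B + 2.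
  (* n ln n and B ln B differ by O(ln B), since |n - B| <= 1 *)
  have lnn : ln n <= ln B + (n / B - 1).
    have : ln (1 + (n / B - 1)) <= n / B - 1.
      by apply: le_ln1Dx; rewrite ltrBrDl subrr divr_gt0.
    rewrite addrC subrK ln_div ?posrE //; lra.
  have : n * ln n <= n * (ln B + (n / B - 1)) by rewrite ler_pM2l.
  have : n * (n / B - 1) <= 2.
    have -> : n * (n / B - 1) = n * (n - B) / B by field; rewrite gt_eqF.
    rewrite ler_pdivrMr // /n; nra.
  have : ln B <= B by exact/ltW/ln_sublinear.
  have : 0 <= ln B by apply: ln_ge0; lra.
  rewrite /n; nra.
have lnr1 : - (n * ln (lambda / 2)) <= 2 * B * `|ln (lambda / 2)|.
  have := ler_norm (- ln (lambda / 2)); rewrite normrN.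
  have := normr_ge0 (ln (lambda / 2)); rewrite /n; nra.
have lnr2 : - (B * ln (nu / 2)) <= 2 * B * `|ln (nu / 2)|.
  have := ler_norm (- ln (nu / 2)); rewrite normrN.
  have := normr_ge0 (ln (nu / 2)); nra.
have nT : (n + B) / T <= 3 / T * B.
  by rewrite mulrAC ler_pM2r ?invr_gt0 // /n; lra.
have sT : (lambda + mu + nu) * T <= (lambda + mu + nu) * T * B.
  by rewrite ler_peMr ?mulr_ge0 ?ltW ?addr_gt0 //; lra.
lra.
Qed.

(** Comparison of the two bounds. For the sign of x2(T), let k2 tend to -oo with
    k1 = k3 = 0: the cost of a path with x2(T) < 0 would exceed any bound. *)
Lemma optimal_spontaneous_bound (R : realType) (lambda mu nu T u : R) :
  0 < lambda -> 0 < mu -> 0 < nu -> 0 < T -> 0 <= u <= 1 ->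
  exists2 M : R, 0 < M & forall (B : R) (x1 x2 x3 : R -> R), 2 <= B ->
    optimal_path lambda mu nu T u B x1 x2 x3 ->
    0 <= x2 T /\ x2 T * ln B <= M * B.
Proof.
move=> l0 m0 n0 T0 hu; have [u0 u1] := andP hu.
have [K hK] := @optimal_rate_le _ _ _ _ _ _ l0 m0 n0 T0 hu.
have s0 : 0 < (lambda + mu + nu) * T by rewrite mulr_gt0 ?addr_gt0.
exists (`|K| + (lambda + mu + nu) * T + 1).
  by have := normr_ge0 K; lra.
move=> B x1 x2 x3 B2 /[dup] xopt [[C1s [x1_01 x10 x20 x30 xB]] _].
have ub := hK _ _ _ _ B2 xopt.
have B_gt0 : 0 < B by lra.
have lnB0 : 0 <= ln B by apply: ln_ge0; lra.
have lnBB : ln B <= B by exact/ltW/ln_sublinear.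
split.
  rewrite leNgt; apply/negP => x2neg.
  (* k * x2 T exceeds the upper bound of the optimal cost *)
  pose k := (`|B * ln B + K * B| + 1) / x2 T.
  have kneg : k < 0 by rewrite /k pmulr_rlt0 ?invr_lt0 // ltr_wpDl.
  have := @rate_function_ge _ lambda mu nu T 0 k 0 0 x1 x2 x3 T0 C1s.
  rewrite x20 !subr0 !mul0r add0r addr0 subr0 oppr0 add0r => lb.
  have {}lb := le_trans (lb _) ub.
  move: lb; rewrite lee_fin /k divfK ?lt_eqF // => lb.
  suff : `|B * ln B + K * B| + 1 <= B * ln B + K * B.
    by have := ler_norm (B * ln B + K * B); lra.
  apply: lb => t tI; have /andP[y0 y1] := x1_01 t tI.
  rewrite mulr0 addr0 ?oppr0 expR0 subrr !mulr0 !(add0r, addr0).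
  apply: mulr_ge0_le0; first by rewrite mulr_ge0 // ltW.
  by rewrite subr_le0 expR_le1; exact: ltW kneg.
have [y0 y1] : 0 <= x1 T /\ x1 T <= 1.
  by apply/andP; apply: x1_01; rewrite in_itv /= lexx ltW.
(* k1 = k3 = ln B and k2 = 2 ln B make each of the three exponents ln B *)
have := @rate_function_ge _ lambda mu nu T (ln B) (2 * ln B) (ln B)
  ((lambda + mu + nu) * B) x1 x2 x3 T0 C1s.
have e2 : - ln B + 2 * ln B = ln B by ring.
rewrite !e2 !lnK ?posrE // => lb.
have {}lb := le_trans (lb _) ub.
move: lb; rewrite lee_fin x10 x20 x30 !subr0 => lb.
have {}lb := lb _.
have : ln B * (x1 T - u) + 2 * ln B * x2 T + ln B * x3 T
    - (lambda + mu + nu) * B * T <= B * ln B + K * B.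
  apply: lb => t tI; have /andP[z0 z1] := x1_01 t tI.
  have h1 : lambda * (1 - x1 t) <= lambda by nra.
  have h2 : mu * x1 t <= mu by nra.
  have h3 : nu * x1 t <= nu by nra.
  have h4 : 0 <= mu * x1 t by nra.
  have h5 : 0 <= nu * x1 t by nra.
  have h6 : 0 <= lambda * (1 - x1 t) by nra.
  nra.
have -> : x3 T = B - x2 T by rewrite -xB; ring.
have : - ln B <= ln B * (x1 T - u) by nra.
have : K * B <= `|K| * B by rewrite ler_pM2r // ler_norm.
lra.
Qed.

Theorem theorem7p1 (R : realType) (lambda mu nu T u : R)
    (hlambda : 0 < lambda) (hmu : 0 < mu) (hnu : 0 < nu) (hT : 0 < T)
    (hu : 0 <= u <= 1)
    (x1 x2 x3 : R -> R -> R)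
    (hopt : forall B : R, 0 < B ->
       optimal_path lambda mu nu T u B (x1 B) (x2 B) (x3 B)) :
  (\forall B \near +oo, x3 B T != 0) /\
  (x2 B T / x3 B T @[B --> +oo] --> 0).
Proof.
have [M M0 hM] :=
  @optimal_spontaneous_bound _ _ _ _ _ _ hlambda hmu hnu hT hu.
(* the bound 2 * M on ln B gives x2 <= B / 2, hence x3 >= B / 2; the bound
   2 * M / e then makes the ratio smaller than e *)
have ratio (e B : R) : 0 < e -> 2 <= B -> expR (2 * M + 2 * M / e) < B ->
    0 < x3 B T /\ 0 <= x2 B T / x3 B T < e.
  move=> e0 B2 hB; have B0 : 0 < B by lra.
  have [x2_ge0 x2B] := hM _ _ _ _ B2 (hopt B B0).
  have [[_ [_ _ _ _ xB]] _] := hopt B B0.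
  have hL : 2 * M + 2 * M / e < ln B.
    by rewrite -ltr_expR lnK ?posrE.
  have Me : 0 < 2 * M / e by rewrite divr_gt0 // mulr_gt0.
  have lnB_e : 2 * M < ln B * e by rewrite -ltr_pdivrMr //; lra.
  have x2_half : x2 B T <= B / 2.
    rewrite leNgt; apply/negP => h.
    have : B / 2 * ln B < x2 B T * ln B by rewrite ltr_pM2r //; lra.
    nra.
  have x3_half : B / 2 <= x3 B T by lra.
  have x3_gt0 : 0 < x3 B T by lra.
  split=> //; rewrite divr_ge0 ?(ltW x3_gt0) //= ltr_pdivrMr //.
  apply: (@lt_le_trans _ _ (e * (B / 2))); last by rewrite ler_pM2l.
  rewrite ltNge; apply/negP => h.
  have lnB0 : 0 < ln B by lra.
  have : e * (B / 2) * ln B <= x2 B T * ln B by rewrite ler_pM2r.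
  nra.
have large (e : R) : \forall B \near +oo, 2 <= B /\ expR (2 * M + 2 * M / e) < B.
  near=> B; split; near: B.
    by apply: nbhs_pinfty_ge; rewrite num_real.
  by apply: nbhs_pinfty_gt; rewrite num_real.
split.
  apply: filterS (large 1) => B [B2 hB].
  by have [x3_gt0 _] := ratio 1 B ltr01 B2 hB; rewrite gt_eqF.
apply/cvgrPdist_lt => e e0; apply: filterS (large e) => B [B2 hB].
have [_ /andP[h1 h2]] := ratio e B e0 B2 hB.
by rewrite sub0r normrN ger0_norm.
Unshelve. all: by end_near. Qed.
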